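(* Let $m = 2k$ with $k \ge 1$, let $r = 2p$ and $n$ be integers with $4 \le r \le 2n-4$, and let $\mathcal{A}$ be an $m$th order $n$ dimensional generalized anti-circulant tensor with circulant index $r$ and generating vector $\mathbf{v} = (v_0, \dots, v_{(n-1)m})^\top$. Suppose $\gcd(m, r) = 2$. Then $\mathcal{A}$ is PSD if and only if $v_0 = v_2 = \cdots = v_{r-2}$, $v_1 = v_3 = \cdots = v_{r-1}$ and $v_0 \ge |v_1|$. In this case, one may write $v_1 = v_0(2t-1)$ with $t \in [0,1]$, and then the Hankel polynomial $f$ of $\mathcal{A}$ satisfies, for all $\mathbf{x} \in \mathbb{R}^n$, $$f(\mathbf{x}) = t v_0 (x_1 + \cdots + x_n)^m + (1-t) v_0 \left(x_1 - x_2 + x_3 - \cdots + (-1)^{n-1} x_n\right)^m.$$ Consequently $\mathcal{A}$ is PSD if and only if it is SOS. Furthermore, in this case (when $\mathcal{A}$ is PSD), $\mathcal{A}$ is a strong Hankel tensor.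
   Context: Let $m, n \ge 2$ and $\mathbf{v} = (v_0, \dots, v_{(n-1)m})^\top \in \mathbb{R}^{(n-1)m+1}$. The $m$th order $n$ dimensional Hankel tensor with generating vector $\mathbf{v}$ is $\mathcal{A} = (a_{i_1 \cdots i_m})$ with $a_{i_1\cdots i_m} = v_{i_1 + \cdots + i_m - m}$ for $i_1, \dots, i_m = 1, \dots, n$. For the present statement, circulant indices $r \le 2n-4$ are allowed (rather than only $r \le n$): $\mathcal{A}$ is called a generalized anti-circulant tensor with circulant index $r$ if $v_i = v_{i+r}$ for all $i = 0, \dots, (n-1)m - r$. The Hankel polynomial of $\mathcal{A}$ is $f(\mathbf{x}) = \sum_{i_1, \dots, i_m = 1}^n v_{i_1 + \cdots + i_m - m}\, x_{i_1} \cdots x_{i_m}$ for $\mathbf{x} = (x_1, \dots, x_n)^\top \in \mathbb{R}^n$. Let $m = 2k$ be even. $\mathcal{A}$ is PSD (positive semi-definite) if $f(\mathbf{x}) \ge 0$ for all $\mathbf{x} \in \mathbb{R}^n$. $\mathcal{A}$ is SOS if $f$ is a sum of squares of polynomials of degree $k$. The associated Hankel matrix is the $(nk-k+1)\times(nk-k+1)$ matrix $A = (a_{ij})$ with $a_{ij} = v_{i+j-2}$ for $i, j = 1, \dots, nk-k+1$. $\mathcal{A}$ is a strong Hankel tensor if $A$ is positive semi-definite. *)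

(* Defs.v *)
From HB Require Import structures.
From mathcomp Require Import all_boot all_order all_algebra.
From mathcomp Require Import reals.
From mathcomp Require Import mpoly.

Set Implicit Arguments.
Unset Strict Implicit.
Unset Printing Implicit Defensive.

Import Order.TTheory GRing.Theory Num.Theory.
Local Open Scope ring_scope.

(* Indices are 0-based throughout: the entry a_{i_1 ... i_m}, 1 <= i_j <= n,
   is the value at the multi-index j |-> i_j - 1. *)
Definition tensor (R : realType) (m n : nat) : Type := {ffun 'I_m -> 'I_n} -> R.

Definition tensor_poly (R : realType) (m n : nat) (A : tensor R m n) :
    {mpoly R[n]} :=
  \sum_(i : {ffun 'I_m -> 'I_n}) A i *: \prod_(j < m) 'X_(i j).

Definition psd_tensor (R : realType) (m n : nat) (A : tensor R m n) : Prop :=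
  forall x : 'I_n -> R, 0 <= (tensor_poly A).@[x].

(* For even m. Since msize is the total degree plus one, the summands have degree
   exactly m / 2; the family may be empty, so the zero polynomial is a sum of
   squares. *)
Definition sos_tensor (R : realType) (m n : nat) (A : tensor R m n) : Prop :=
  exists2 qs : seq {mpoly R[n]},
    forall q, q \in qs -> msize q = (m./2).+1 &
    tensor_poly A = \sum_(q <- qs) q ^+ 2.

Definition psd_mx (R : realType) (d : nat) (M : 'M[R]_d) : Prop :=
  forall x : 'cV[R]_d, 0 <= (x^T *m M *m x) 0 0.

(* v_i; inord truncates to index 0 when i > N, but only indices i <= N are
   used below. *)
Definition entry (R : realType) (N : nat) (v : 'cV[R]_N.+1) (i : nat) : R :=
  v (inord i) 0.

(* With 0-based indices, the offset i_1 + ... + i_m - m is the plain sum. *)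
Definition hankel_tensor (R : realType) (m n : nat)
    (v : 'cV[R]_(n.-1 * m).+1) : tensor R m n :=
  fun i => entry v (\sum_(j < m) i j).

Definition gen_anticirculant (R : realType) (m n : nat)
    (v : 'cV[R]_(n.-1 * m).+1) (r : nat) : Prop :=
  forall i : nat, (i + r <= n.-1 * m)%N -> entry v i = entry v (i + r).

(* For m = 2k and n > 0 the size (n - 1)k + 1 is nk - k + 1. *)
Definition hankel_mx (R : realType) (m n : nat) (v : 'cV[R]_(n.-1 * m).+1) :
    'M[R]_((n.-1 * m./2).+1) :=
  \matrix_(i, j) entry v (i + j).

Definition strong_hankel (R : realType) (m n : nat)
    (v : 'cV[R]_(n.-1 * m).+1) : Prop :=
  psd_mx (hankel_mx v).

(* Main.v *)
Require Import Defs.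
From HB Require Import structures.
From mathcomp Require Import all_boot all_order all_algebra.
From mathcomp Require Import reals.
From mathcomp Require Import mpoly.
From mathcomp Require Import zify ring lra.

Set Implicit Arguments.
Unset Strict Implicit.
Unset Printing Implicit Defensive.

Import Order.TTheory GRing.Theory Num.Theory.
Local Open Scope ring_scope.

(** The idea.  Extend the generating vector to a sequence V on nat of period
    r = 2p and let [moment V] be the linear functional on polynomials in one
    variable that maps 'X^s to V s.  Expanding a power of a sum shows that the
    Hankel polynomial at x is [moment V (P ^+ m)], where P is the polynomial of
    degree at most n - 1 with coefficient vector x ([hankel_meval_moment]).
    Under [moment V], multiplication by 'X^2 - 1 takes the difference of V
    with step 2, and multiplication by 'X shifts V.

    Suppose that the tensor is PSD and test it on P_l = 'X^l * ('X^2 - 1) for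
    l < p, which is possible because l + 2 <= n - 1.  The value at P_l is the
    m-th difference of V at l * m = 2 * (l * k).  As k is coprime to p, the
    numbers l * k run over all residues mod p, so the sum of these p values is
    the sum of a difference over a full period, which is 0.  Being nonnegative,
    the values all vanish: the m-th difference of V is 0 at even indices.  Each
    P_l is therefore a minimum of the form, and stationarity in the direction
    'X^(l+1) says that the (m-1)-th difference is 0 at l * m + 1, hence at all
    odd indices.  A periodic sequence one of whose iterated differences is 0 is
    constant ([diff_vanish_parity]), so V s depends on the parity of s only
    ([periodic_psd_parity]).

    Such a V has the form V s = c + d * (-1)^s, so that the Hankel polynomial is
    c * (sum of x_i)^m + d * (alternating sum of x_i)^m
    ([hankel_poly_parity]).  The two linear forms can be made to vanish
    separately, so PSD means 0 <= c and 0 <= d, that is |v_1| <= v_0.  The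
    remaining assertions are read off from this formula and from its analogue
    for the Hankel matrix. *)

(** * Differences of periodic sequences *)

Lemma sum_periodic_diff (V : zmodType) (h : nat -> V) (p : nat) :
  h p = h 0%N -> \sum_(j < p) (h j.+1 - h j) = 0.
Proof.
move=> hp.
by rewrite -(big_mkord xpredT (fun j => h j.+1 - h j)) telescope_sumr // hp subrr.
Qed.

(** Constant differences make the sequence an arithmetic progression, and
    periodicity leaves 0 as the only possible common difference. *)
Lemma periodic_diff2_eq0 (R : numDomainType) (h : nat -> R) (p : nat) :
  (0 < p)%N -> h p = h 0%N ->
  (forall j, h j.+2 - h j.+1 = h j.+1 - h j) -> forall j, h j.+1 = h j.
Proof.
move=> p_gt0 hp h2.
have hc j : h j.+1 - h j = h 1%N - h 0%N by elim: j => // j <-; exact: h2.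
have := sum_periodic_diff hp.
rewrite (eq_bigr (fun=> h 1%N - h 0%N)) => [|j _]; last exact: hc.
rewrite sumr_const card_ord => /eqP; rewrite mulrn_eq0 eqn0Ngt p_gt0 /= => /eqP h0.
by move=> j; apply/eqP; rewrite -subr_eq0 hc h0.
Qed.

Lemma periodic_modn (T : Type) (h : nat -> T) (p : nat) :
  (forall j, h (j + p)%N = h j) -> forall j, h (j %% p)%N = h j.
Proof.
move=> hp j; rewrite [in RHS](divn_eq j p) addnC.
by elim: (j %/ p)%N => [|q IH]; rewrite ?addn0 // mulSn addnCA addnC hp.
Qed.

Lemma ltn_pmodM (p : nat) (k : nat) (l : 'I_p) : (l * k %% p < p)%N.
Proof. by rewrite ltn_mod (leq_ltn_trans _ (ltn_ord l)). Qed.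

Definition ord_mulm (p k : nat) (l : 'I_p) : 'I_p := Ordinal (ltn_pmodM k l).

Lemma ord_mulm_inj (p k : nat) : coprime k p -> injective (@ord_mulm p k).
Proof.
move=> kp l1 l2 /(congr1 val) /= /eqP.
wlog le12 : l1 l2 / (l1 <= l2)%N => [H|].
  by case: (leqP l1 l2) => [|/ltnW] /H // H' e; rewrite H' // eq_sym.
rewrite eq_sym eqn_mod_dvd ?leq_mul2r ?le12 ?orbT // -mulnBl.
rewrite Gauss_dvdl 1?coprime_sym // => dv.
apply: val_inj => /=.
have [|d_gt0] := posnP (l2 - l1)%N; first by lia.
by have := dvdn_leq d_gt0 dv; have := ltn_ord l2; lia.
Qed.

(** Multiplication by a unit k permutes the residues mod p. *)
Lemma sum_periodic_mull (V : zmodType) (h : nat -> V) (p k : nat) :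
  coprime k p -> (forall j, h (j + p)%N = h j) ->
  \sum_(l < p) h (l * k)%N = \sum_(j < p) h j.
Proof.
move=> kp hp; rewrite [RHS](reindex_inj (ord_mulm_inj kp)).
by apply: eq_bigr => l _ /=; rewrite periodic_modn.
Qed.

Lemma periodic_mull_cover (T : Type) (h : nat -> T) (c : T) (p k : nat) :
  (0 < p)%N -> coprime k p -> (forall j, h (j + p)%N = h j) ->
  (forall l, (l < p)%N -> h (l * k)%N = c) -> forall j, h j = c.
Proof.
move=> p0 kp hp hl j.
have [g _ gK] := injF_bij (ord_mulm_inj kp).
have /(congr1 val) /= e := gK (Ordinal (ltn_pmod j p0)).
by rewrite -(periodic_modn hp) -e periodic_modn // hl.
Qed.

(** * Moment functional *)

Section Moment.
Variable (R : realFieldType).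
Implicit Types (V : nat -> R) (P Q : {poly R}).

(** The linear functional sending 'X^i to V i; the sum over coefficients makes
    it total on polynomials of any degree. *)
Definition moment V P : R := \sum_(i < size P) P`_i * V i.

Lemma moment_widen V N P : (size P <= N)%N -> moment V P = \sum_(i < N) P`_i * V i.
Proof.
move=> sP; rewrite /moment (big_ord_widen N (fun i => P`_i * V i) sP) big_mkcond.
apply: eq_bigr => i _; case: ltnP => // /(nth_default 0) ->.
by rewrite mul0r.
Qed.

Fact moment_is_scalar V : scalar (moment V).
Proof.
move=> a P Q; set N := maxn (size P) (size Q).
rewrite (@moment_widen V N P) ?leq_maxl // (@moment_widen V N Q) ?leq_maxr //.
rewrite (@moment_widen V N); last first.
  by rewrite (leq_trans (size_polyD _ _)) // geq_max leq_maxr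
             (leq_trans (size_scale_leq _ _)) ?leq_maxl.
rewrite mulr_sumr -big_split; apply: eq_bigr => i _ /=.
by rewrite coefD coefZ mulrDl mulrA.
Qed.

HB.instance Definition _ V :=
  GRing.isLinear.Build R {poly R} R *%R (moment V) (moment_is_scalar V).

Lemma momentXn V s : moment V 'X^s = V s.
Proof.
rewrite /moment size_polyXn big_ord_recr /= coefXn eqxx mul1r big1 ?add0r // => i _.
by rewrite coefXn ltn_eqF ?mul0r.
Qed.

(** The first-order condition at a minimum at 0 of value 0: near 0 the terms of
    degree at least 2 are bounded by C * e ^ 2, which cannot compensate a
    nonzero linear term of the wrong sign. *)
Lemma coef1_ge0_min (q : {poly R}) :
  (forall e, 0 <= q.[e]) -> q`_0 = 0 -> q`_1 = 0.
Proof.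
move=> q_ge0 q0; set a := q`_1.
have [u qE] : exists u, q = a *: 'X + u * 'X^2.
  exists (drop_poly 2 q); rewrite -[LHS](poly_take_drop 2); congr (_ + _).
  apply/polyP=> i; rewrite coef_take_poly coefZ coefX.
  by case: i => [|[|i]] /=; rewrite ?mulr0 ?mulr1.
have [C uC] : exists C : R, forall x : R, `|x| <= 1 -> `|u.[x]| <= C.
  by have [C uC] := poly_disk_bound u 1; exists C.
have C0 : 0 <= C.
  have := uC 0; rewrite normr0 ler01 => /(_ isT).
  exact/le_trans/normr_ge0.
have lb (e : R) : `|e| <= 1 -> 0 <= a * e + C * e ^+ 2.
  move=> /uC ue; apply: (le_trans (q_ge0 e)).
  have -> : q.[e] = a * e + u.[e] * e ^+ 2 by rewrite qE !hornerE; ring.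
  by rewrite lerD2l ler_wpM2r ?sqr_ge0 // (le_trans (ler_norm _)).
apply/eqP; case: (eqVneq a 0) => // an0; exfalso.
(* At e = - a / D the linear term beats the bound C * e ^ 2 as soon as D > C,
   and D >= `|a| keeps `|e| <= 1. *)
pose D := 1 + C + `|a|.
have D0 : 0 < D by have := normr_ge0 a; rewrite /D; lra.
have := lb (- (a / D)); rewrite normrN normrM normfV (gtr0_norm D0) ler_pdivrMr //.
have /[swap]/[apply] : `|a| <= 1 * D by rewrite /D; lra.
have -> : a * - (a / D) + C * (- (a / D)) ^+ 2 = - ((a / D) ^+ 2 * (D - C)).
  by field; exact: lt0r_neq0.
rewrite oppr_ge0 leNgt mulr_gt0 //; last first.
  by have := normr_ge0 a; rewrite /D; lra.
by rewrite exprn_even_gt0 //= mulf_neq0 // invr_eq0 lt0r_neq0.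
Qed.

(** The form P |-> moment V (P ^+ m) has derivative
    m * moment V (P ^+ m.-1 * Q) at P in the direction Q; where the form vanishes
    it is minimal along this line, so the derivative is 0. *)
Lemma moment_stationary V m P Q :
  (0 < m)%N -> (forall e, 0 <= moment V ((P + e *: Q) ^+ m)) ->
  moment V (P ^+ m) = 0 -> moment V (P ^+ m.-1 * Q) = 0.
Proof.
case: m => // m _ ge0 P0.
(* q is the form along the line e |-> P + e *: Q, as a polynomial in e. *)
pose q := \poly_(i < m.+2) (moment V (P ^+ (m.+1 - i) * Q ^+ i) *+ 'C(m.+1, i)).
have qE e : q.[e] = moment V ((P + e *: Q) ^+ m.+1).
  rewrite horner_poly exprDn linear_sum; apply: eq_bigr => i _ /=.
  by rewrite exprZn -scalerAr linearMn linearZ /= mulrnAl [_ * e ^+ i]mulrC.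
have q_ge0 e : 0 <= q.[e] by rewrite qE.
have := coef1_ge0_min q_ge0.
rewrite !coef_poly /= !subn0 subn1 bin0 bin1 !expr0 mulr1 expr1 => /(_ P0) /eqP.
by rewrite mulrn_eq0 /= => /eqP.
Qed.

Lemma moment_shift_diff V s d :
  moment V ('X^s * ('X^2 - 1) ^+ d.+1) =
  moment V ('X^(s + 2) * ('X^2 - 1) ^+ d) - moment V ('X^s * ('X^2 - 1) ^+ d).
Proof. by rewrite -linearB /= exprS exprD; congr moment; ring. Qed.

Section Periodic.
Variables (V : nat -> R) (p : nat).
Hypothesis V_per : forall s, V (s + 2 * p)%N = V s.

(** The d-th difference of the subsequence j |-> V (2 * j + e). *)
Let W d e j := moment V ('X^(2 * j + e) * ('X^2 - 1) ^+ d).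

Let WS d e j : W d.+1 e j = W d e j.+1 - W d e j.
Proof.
rewrite /W moment_shift_diff; congr (moment V ('X^_ * _) - _); lia.
Qed.

Let W_per d e j : W d e (j + p) = W d e j.
Proof.
elim: d j => [|d IH] j; last by rewrite !WS -addSn !IH.
by rewrite /W !mulr1 !momentXn mulnDr addnAC V_per.
Qed.

(** A difference of order d.+2 that vanishes makes the one of order d.+1 constant;
    this is a difference of a periodic sequence, so the constant is 0.
    Iterating brings the order down to 1. *)
Lemma diff_vanish_parity e d : (0 < p)%N ->
  (forall j, moment V ('X^(2 * j + e) * ('X^2 - 1) ^+ d.+1) = 0) ->
  forall j, V (2 * j + e + 2)%N = V (2 * j + e)%N.
Proof.
move=> p0; rewrite -/(forall j, W d.+1 e j = 0); elim: d => [|d IH] H j.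
  have := H j; rewrite WS /W !mulr1 !momentXn mulnS => /eqP; rewrite subr_eq0.
  by move/eqP <-; congr V; lia.
apply: IH => i; rewrite WS (@periodic_diff2_eq0 _ (W d e) p) ?subrr //.
  exact: (W_per d e 0).
by move=> l; apply/eqP; rewrite -subr_eq0 -!WS H.
Qed.

(** The test polynomials 'X^l * ('X^2 - 1), l < p, are minima of the form:
    their values are nonnegative and sum to 0 by periodicity.  The minimum value
    controls the even indices and the gradient there the odd ones. *)
Lemma periodic_psd_parity n k :
  (0 < k)%N -> coprime k p -> (0 < p)%N -> (p.+2 <= n)%N ->
  (forall P, (size P <= n)%N -> 0 <= moment V (P ^+ (2 * k))) ->
  forall s, V (s + 2)%N = V s.
Proof.
move=> k0 kp p0 pn psd.
pose P l : {poly R} := 'X^l * ('X^2 - 1).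
(* p.+2 <= n is exactly what admits all l < p, as many as are needed for the
   l * k to cover all residues mod p. *)
have sP l : (l < p)%N -> (size (P l) <= n)%N.
  move=> lp; rewrite (leq_trans (size_polyMleq _ _)) // size_polyXn.
  by rewrite size_XnsubC //=; lia.
have PE l d : P l ^+ d = 'X^(l * d) * ('X^2 - 1) ^+ d by rewrite exprMn exprM.
have m1 : (2 * k).-1.+1 = (2 * k)%N by lia.
have P0 l : (l < p)%N -> moment V (P l ^+ (2 * k)) = 0.
  have ge0 (i : 'I_p) : true -> 0 <= W (2 * k) 0 (i * k).
    by move=> _; have := psd _ (sP i (ltn_ord i)); rewrite PE /W addn0 mulnCA.
  have : \sum_(i < p) W (2 * k) 0 (i * k) = 0.
    rewrite (sum_periodic_mull kp (W_per _ _)) -m1.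
    rewrite (eq_bigr _ (fun i _ => WS _ _ _)) sum_periodic_diff //.
    exact: (W_per _ _ 0).
  move/eqP; rewrite psumr_eq0 // => /allP H lp.
  have := H (Ordinal lp); rewrite mem_index_enum /= => /(_ isT) /eqP.
  by rewrite PE /W addn0 mulnCA.
have even0 : forall j, W (2 * k) 0 j = 0.
  apply: (periodic_mull_cover p0 kp (W_per _ _)) => l /P0.
  by rewrite PE /W addn0 mulnCA.
have odd0 : forall j, W (2 * k).-1 1 j = 0.
  apply: (periodic_mull_cover p0 kp (W_per _ _)) => l lp.
  (* The exponent l.+1 cancels the defect l * (2 * k).-1 = l * (2 * k) - l and
     makes the total exponent odd. *)
  have : moment V (P l ^+ (2 * k).-1 * 'X^(l.+1)) = 0.
    apply: moment_stationary; [lia| |exact: P0] => e.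
    apply: psd; rewrite (leq_trans (size_polyD _ _)) // geq_max sP //=.
    by rewrite (leq_trans (size_scale_leq _ _)) // size_polyXn; lia.
  rewrite PE mulrAC -exprD /W => <-; congr (moment V ('X^_ * _)).
  by rewrite -{1}m1; lia.
move=> s; have k2 : (2 * k).-1 = (2 * k).-2.+1 by lia.
have -> : s = (2 * s./2 + odd s)%N by rewrite -{1}(odd_double_half s) -muln2; lia.
case: (odd s).
  by apply: (@diff_vanish_parity 1 (2 * k).-2) => // j; rewrite -k2; apply: odd0.
by apply: (@diff_vanish_parity 0 (2 * k).-1) => // j; rewrite m1; apply: even0.
Qed.

End Periodic.
End Moment.

(** * Hankel polynomials *)

Lemma sum_expr_ffun (S : comNzSemiRingType) (n m : nat) (y : 'I_n -> S) :
  (\sum_i y i) ^+ m = \sum_(i : {ffun 'I_m -> 'I_n}) \prod_j y (i j).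
Proof.
rewrite -(bigA_distr_bigA (fun (_ : 'I_m) i => y i)) /=.
by rewrite prodr_const card_ord.
Qed.

Section Hankel.
Variables (R : realType) (m n : nat) (v : 'cV[R]_(n.-1 * m).+1).
Local Notation f := (tensor_poly (@hankel_tensor R m n v)).

Lemma hankel_index_le (i : {ffun 'I_m -> 'I_n}) :
  (\sum_(j < m) i j <= n.-1 * m)%N.
Proof.
rewrite (@leq_trans (\sum_(j < m) n.-1)) //; last by rewrite sum_nat_const card_ord mulnC.
by apply: leq_sum => j _; have := ltn_ord (i j); lia.
Qed.

(** A Hankel form sees its argument only through the product of m copies of the
    polynomial with coefficients x, because the entry depends only on the sum of
    the indices, which is the exponent of the corresponding monomial. *)
Lemma hankel_meval_moment (V : nat -> R) (x : 'I_n -> R) :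
  (forall s, (s <= n.-1 * m)%N -> entry v s = V s) ->
  f.@[x] = moment V ((\sum_i x i *: 'X^i) ^+ m).
Proof.
move=> vV; rewrite sum_expr_ffun raddf_sum linear_sum /=; apply: eq_bigr => i _.
rewrite mevalZ scaler_prod linearZ /= prodrXr momentXn -vV ?hankel_index_le //.
rewrite mulrC rmorph_prod /=; congr (_ * _).
by apply: eq_bigr => j _; rewrite mevalXU.
Qed.

Lemma hankel_psd_moment (V : nat -> R) :
  (forall s, (s <= n.-1 * m)%N -> entry v s = V s) ->
  psd_tensor (@hankel_tensor R m n v) ->
  forall P : {poly R}, (size P <= n)%N -> 0 <= moment V (P ^+ m).
Proof.
move=> vV psd P sP; have := psd (fun i => P`_i).
by rewrite (hankel_meval_moment _ vV) -(poly_def n (fun i => P`_i))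
           -/(take_poly n P) take_poly_id.
Qed.

Variables c d : R.
Hypothesis v_parity : forall s, (s <= n.-1 * m)%N -> entry v s = c + d * (-1) ^+ s.

(** The rank-one sequences 1 and (-1) ^ s generate the powers of the linear forms
    with coefficients 1 and (-1) ^ i, since (-1) ^ s is multiplicative in s. *)
Lemma hankel_poly_parity :
  f = c *: (\sum_i 'X_i) ^+ m + d *: (\sum_(i < _) (-1) ^+ i *: 'X_i) ^+ m.
Proof.
rewrite !sum_expr_ffun !scaler_sumr -big_split; apply: eq_bigr => i _ /=.
rewrite /hankel_tensor v_parity ?hankel_index_le // scalerDl; congr (_ + _).
by rewrite scaler_prod prodrXr scalerA.
Qed.

Lemma hankel_meval_parity (x : 'I_n -> R) :
  f.@[x] = c * (\sum_i x i) ^+ m + d * (\sum_(i < n) (-1) ^+ i * x i) ^+ m.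
Proof.
rewrite hankel_poly_parity mevalD !mevalZ !rmorphXn /= !raddf_sum /=.
congr (_ * _ ^+ m + _ * _ ^+ m); apply: eq_bigr => i _; rewrite ?mevalZ mevalXU //.
Qed.

(** The decomposition of the tensor at order 2: the quadratic form of the Hankel
    matrix is c and d times the squares of the same two linear forms, in
    n.-1 * m./2 + 1 variables. *)
Lemma strong_hankel_parity : ~~ odd m -> 0 <= c -> 0 <= d -> @strong_hankel R m n v.
Proof.
move=> me c0 d0 x.
suff -> : (x^T *m hankel_mx v *m x) 0 0 =
    c * (\sum_i x i 0) ^+ 2 + d * (\sum_(i < _) (-1) ^+ i * x i 0) ^+ 2.
  by rewrite addr_ge0 // mulr_ge0 // sqr_ge0.
rewrite mxE !expr2 !mulr_sumr -big_split; apply: eq_bigr => j _ /=.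
rewrite mxE !mulrA !mulr_sumr !mulr_suml -big_split; apply: eq_bigr => i _ /=.
rewrite !mxE v_parity ?exprD; first by ring.
have := ltn_ord i; have := ltn_ord j; rewrite !ltnS => hj hi.
rewrite -[X in (_ <= _ * X)%N](odd_double_half m) (negbTE me) add0n -addnn mulnDr.
exact: leq_add.
Qed.
End Hankel.

(** A power of a nonzero linear form is nonzero and homogeneous of degree k. *)
Lemma msize_linear_form_exp (R : realType) (n k : nat) (a : 'I_n -> R) (i0 : 'I_n) :
  a i0 != 0 -> msize ((\sum_i a i *: 'X_i : {mpoly R[n]}) ^+ k) = k.+1.
Proof.
move=> a0; set l := \sum_i _.
have l0 : l != 0.
  apply: contra_neq a0 => /(congr1 (meval (fun i => (i == i0)%:R))).
  rewrite raddf_sum /= raddf0 (bigD1 i0) //= big1 ?addr0 => [|i ne].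
    by rewrite mevalZ mevalXU eqxx mulr1.
  by rewrite mevalZ mevalXU (negbTE ne) mulr0.
have hl : l ^+ k \is (1 * k).-homog.
  apply: dhomogMn; apply: rpred_sum => i _; apply: dhomogZ.
  by rewrite dhomogX /= mdeg1.
have lk0 : l ^+ k != 0 by rewrite expf_neq0.
have := dhomog_uniq lk0 (dhomog_msize hl) hl; rewrite mul1n.
have : msize (l ^+ k) != 0%N by rewrite mmeasure_poly_eq0.
by case: (msize _) => //= N _ ->.
Qed.

(** * Tensors whose entries depend on parity *)

Lemma sos_psd (R : realType) (m n : nat) (A : tensor R m n) :
  sos_tensor A -> psd_tensor A.
Proof.
move=> [qs _ A_sos] x; rewrite A_sos raddf_sum /=; apply: sumr_ge0 => q _.
by rewrite rmorphXn /= sqr_ge0.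
Qed.

(** Squares of degree exactly k are required, so for c = 0 the family has to be
    empty rather than consist of the zero polynomial. *)
Lemma sos_linear_form_exp (R : realType) (n k : nat) (c : R) (a : 'I_n -> R)
    (i0 : 'I_n) : 0 <= c -> a i0 != 0 ->
  exists2 qs : seq {mpoly R[n]},
    forall q, q \in qs -> msize q = k.+1 &
    c *: (\sum_i a i *: 'X_i) ^+ (2 * k) = \sum_(q <- qs) q ^+ 2.
Proof.
move=> c0 ai0; case: (eqVneq c 0) => [->|cn0].
  by exists [::] => //; rewrite scale0r big_nil.
exists [:: Num.sqrt c *: (\sum_i a i *: 'X_i) ^+ k] => [q|].
  rewrite inE => /eqP ->; rewrite msizeZ ?(msize_linear_form_exp _ ai0) //.
  by rewrite sqrtr_eq0 -ltNge lt_def cn0.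
by rewrite big_seq1 exprZn sqr_sqrtr // -exprM mulnC.
Qed.

Lemma sum_two_points (R : nzRingType) (n : nat) (g : nat -> R) (e : R) :
  (2 <= n)%N ->
  \sum_(i < n) g i * ((val i == 0%N)%:R + (val i == 1%N)%:R * e) = g 0%N + g 1%N * e.
Proof.
case: n => [|[|n]] // _; rewrite !big_ord_recl big1 /= => [|i _].
  by rewrite !(mulr1n, mulr0n) !(mul1r, mul0r, mulr1, addr0, add0r).
by rewrite !(mul0r, mulr0n, addr0) mulr0.
Qed.

Section Parity.
Variables (R : realType) (k n : nat) (v : 'cV[R]_(n.-1 * (2 * k)).+1) (c d : R).
Hypothesis k0 : (0 < k)%N.
Hypothesis n_ge2 : (2 <= n)%N.
Hypothesis v_parity :
  forall s, (s <= n.-1 * (2 * k))%N -> entry v s = c + d * (-1) ^+ s.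

(** On x = (1, e, 0, ..., 0) the two linear forms take the values 1 + e and
    1 - e, so e = 1 and e = -1 isolate the signs of c and d. *)
Lemma hankel_psd_parity :
  psd_tensor (@hankel_tensor R (2 * k) n v) <-> 0 <= c /\ 0 <= d.
Proof.
split=> [psd|[c0 d0] x]; last first.
  rewrite (hankel_meval_parity v_parity) !exprM.
  by rewrite addr_ge0 // mulr_ge0 // exprn_ge0 // sqr_ge0.
have two e : 0 <= c * (1 + e) ^+ (2 * k) + d * (1 - e) ^+ (2 * k).
  have := psd (fun i => (val i == 0%N)%:R + (val i == 1%N)%:R * e).
  rewrite (hankel_meval_parity v_parity) (sum_two_points (fun i => (-1) ^+ i)) //.
  under eq_bigr do rewrite -[_ + _]mul1r.
  by rewrite (sum_two_points (fun=> 1)) // expr0 expr1 mul1r mulN1r.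
have pow2 : 0 < (1 + 1 : R) ^+ (2 * k) by rewrite exprn_gt0 // addr_gt0.
have z : (0 : R) ^+ (2 * k) = 0 by rewrite expr0n muln_eq0 /= eqn0Ngt k0.
split.
  by have := two 1; rewrite subrr z mulr0 addr0 pmulr_lge0.
by have := two (-1); rewrite subrr z mulr0 add0r opprK pmulr_lge0.
Qed.

Lemma hankel_sos_parity :
  0 <= c -> 0 <= d -> sos_tensor (@hankel_tensor R (2 * k) n v).
Proof.
move=> c0 d0; pose i0 : 'I_n := Ordinal (ltnW n_ge2).
have [qs1 s1 e1] := @sos_linear_form_exp R n k c (fun=> 1) i0 c0 (oner_neq0 _).
have [qs2 s2 e2] := @sos_linear_form_exp R n k d (fun i => (-1) ^+ i) i0 d0 (oner_neq0 _).
exists (qs1 ++ qs2) => [q|].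
  by rewrite mul2n doubleK mem_cat => /orP[/s1|/s2].
rewrite (hankel_poly_parity v_parity) big_cat /= -e1 -e2.
by under [in RHS]eq_bigr do rewrite scale1r.
Qed.
End Parity.

(** * Generalized anti-circulant tensors *)

Lemma entry_periodic (R : realType) (m n r : nat) (v : 'cV[R]_(n.-1 * m).+1) :
  (r <= n.-1 * m)%N -> gen_anticirculant v r ->
  forall s, (s <= n.-1 * m)%N -> entry v s = entry v (s %% r).
Proof.
move=> rN hv s sN.
have H q : (q * r + s %% r <= n.-1 * m)%N -> entry v (q * r + s %% r) = entry v (s %% r).
  elim: q => [//|q IH] le; rewrite -IH; last by lia.
  by rewrite [RHS]hv; [congr entry; lia|lia].
by rewrite {1}(divn_eq s r) H // -divn_eq.
Qed.

Theorem theorem5 (R : realType) (m k r p n : nat)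
    (hm : m = (2 * k)%N) (hk : (1 <= k)%N) (hr : r = (2 * p)%N)
    (hr4 : (4 <= r)%N) (hrn : (r <= 2 * n - 4)%N)
    (v : 'cV[R]_(n.-1 * m).+1)
    (hv : @gen_anticirculant R m n v r)
    (hgcd : gcdn m r = 2%N) :
  [/\ psd_tensor (@hankel_tensor R m n v) <->
        [/\ forall i : nat, (i < p)%N -> entry v (2 * i) = entry v 0,
            forall i : nat, (i < p)%N -> entry v (2 * i + 1) = entry v 1
          & `|entry v 1| <= entry v 0],
      psd_tensor (@hankel_tensor R m n v) ->
        (exists t : R, 0 <= t <= 1 /\ entry v 1 = entry v 0 * (2 * t - 1)) /\
        (forall t : R, 0 <= t <= 1 -> entry v 1 = entry v 0 * (2 * t - 1) ->
         forall x : 'I_n -> R,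
           (tensor_poly (@hankel_tensor R m n v)).@[x] =
             t * entry v 0 * (\sum_(i < n) x i) ^+ m
             + (1 - t) * entry v 0 * (\sum_(i < n) (-1) ^+ i * x i) ^+ m),
      psd_tensor (@hankel_tensor R m n v) <->
        sos_tensor (@hankel_tensor R m n v)
    & psd_tensor (@hankel_tensor R m n v) -> @strong_hankel R m n v].
Proof.
have n2 : (2 <= n)%N by lia.
have pn : (p.+2 <= n)%N by lia.
have rN : (r <= n.-1 * m)%N by nia.
have p0 : (0 < p)%N by lia.
have r1 : (1 < r)%N by lia.
have ckp : coprime k p.
  by move: hgcd; rewrite hm hr -muln_gcdr /coprime => h; apply/eqP; lia.
subst m.
set a := entry v 0; set b := entry v 1.
set f := hankel_tensor v.
pose c := (a + b) / 2; pose d := (a - b) / 2.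
have v_mod := entry_periodic rN hv.
(* The unique c and d with a = c + d and b = c - d. *)
have parity_value s : (if odd s then b else a) = c + d * (-1) ^+ s.
  by rewrite -signr_odd /c /d; case: (odd s); rewrite ?expr0 ?expr1; field.
have psd_parity : psd_tensor f ->
    forall s, (s <= n.-1 * (2 * k))%N -> entry v s = c + d * (-1) ^+ s.
  move=> /(hankel_psd_moment v_mod) psd s sN; rewrite v_mod // -parity_value.
  have V_per j : entry v ((j + 2 * p) %% r) = entry v (j %% r).
    by rewrite -hr modnDr.
  rewrite -(periodic_modn (periodic_psd_parity V_per hk ckp p0 pn psd) s) modn2.
  by case: (odd s); rewrite /= modn_small // ltnW.
have psd_cd : psd_tensor f -> 0 <= c /\ 0 <= d.
  by move=> psd; apply/(hankel_psd_parity hk n2 (psd_parity psd)).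
have even_m : ~~ odd (2 * k) by rewrite oddM.
split.
- split=> [psd|[ev od ab]].
    have [c0 d0] := psd_cd psd; have vp := psd_parity psd.
    split=> [i ip|i ip|].
    + by rewrite vp; [rewrite -parity_value oddM | lia].
    + by rewrite vp; [rewrite -parity_value oddD oddM | lia].
    + by rewrite ler_norml; move: c0 d0; rewrite /c /d; lra.
  have vp s : (s <= n.-1 * (2 * k))%N -> entry v s = c + d * (-1) ^+ s.
    move=> sN; rewrite v_mod // -parity_value.
    have -> : odd s = odd (s %% r) by rewrite odd_mod // hr oddM.
    have := ltn_pmod s (ltnW r1); move: (s %% r)%N => t tr.
    have t2 : (t./2 < p)%N by lia.
    rewrite -{1}(odd_double_half t) -mul2n addnC.
    by case: (odd t); rewrite ?od // addn0 ev.
  apply/(hankel_psd_parity hk n2 vp).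
  by move: ab; rewrite ler_norml /c /d; lra.
- move=> psd; have [c0 d0] := psd_cd psd; split.
    (* v_0 = a = c + d, so t is the share of c; when a = 0, inversion gives t = 0. *)
    exists (c / a); have [a0|a0] := eqVneq a 0.
      by move: c0 d0; rewrite a0 invr0 mulr0 /c /d a0; lra.
    have a_gt0 : 0 < a by rewrite lt_def a0 /=; move: c0 d0; rewrite /c /d; lra.
    split; last by rewrite /c; field.
    rewrite divr_ge0 //=; last exact: ltW.
    by rewrite ler_pdivrMr // mul1r; move: d0; rewrite /c /d; lra.
  move=> t _ bt x; rewrite (hankel_meval_parity (psd_parity psd)).
  by congr (_ * _ + _ * _); rewrite /c /d bt; field.
- split=> [psd|]; last exact: sos_psd.
  have [c0 d0] := psd_cd psd.
  exact: (hankel_sos_parity n2 (psd_parity psd) c0 d0).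
- move=> psd; have [c0 d0] := psd_cd psd.
  exact: (strong_hankel_parity (psd_parity psd) even_m c0 d0).
Qed.
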